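(* Let $I_1,I_2,I_3\subseteq\mathbb{R}$ be open intervals (bounded or unbounded), let $a<b$ with $[a,b]\subset I_1$, and let $y_a,y_b\in\mathbb{R}$. Let $\Omega$ be a real-valued $C^1$ function on an open interval containing $I_1\cup I_2\cup I_3$, with $\Omega'>0$, and let $L:I_1\times I_2\times I_3\to\mathbb{R}$ have continuous partial derivatives up to second order. Consider the variational problem $$\min\ \mathcal{L}(y)=\int_a^b L\big(x,y(x),D_\Omega y(x)\big)\,\Omega'(x)\,dx,\qquad y(a)=y_a,\quad y(b)=y_b,$$ over functions $y\in C^2[a,b]$ with $y(x)\in I_2$ and $D_\Omega y(x)\in I_3$ for all $x\in[a,b]$. Suppose that $L$ is jointly convex (in the Omega sense defined in the context) in its second and third variables. If $\tilde y$ belongs to this class of functions, satisfies $\tilde y(a)=y_a$, $\tilde y(b)=y_b$, and satisfies $$D_\Omega\big(D_\Omega^3 L(x,\tilde y(x),D_\Omega \tilde y(x))\big)=D_\Omega^2 L(x,\tilde y(x),D_\Omega \tilde y(x))\qquad\text{for all }x\in[a,b],$$ then $\tilde y$ is a global minimizer of the variational problem, i.e. $\mathcal{L}(\tilde y)\le\mathcal{L}(y)$ for every $y$ in this class with $y(a)=y_a$ and $y(b)=y_b$.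
   Context: For a function $f$ of one variable, the $\Omega$-derivative at $x_0$ is $D_\Omega f(x_0)=\lim_{x\to x_0}\frac{f(x)-f(x_0)}{\Omega(x)-\Omega(x_0)}$ when this limit exists (one-sided at endpoints of a closed interval); if $f'(x_0)$ exists and $\Omega'(x_0)\neq0$, it equals $f'(x_0)/\Omega'(x_0)$. For a $C^1$ function $f(x_1,\dots,x_n)$, the Omega partial derivative with respect to the $i$-th variable is $D_\Omega^i f(x_1,\dots,x_n)=\frac{1}{\Omega'(x_i)}\frac{\partial f}{\partial x_i}(x_1,\dots,x_n)$ (superscript $i$ is an index, not a power). Thus $D_\Omega^2L(x,y(x),D_\Omega y(x))$ and $D_\Omega^3L(x,y(x),D_\Omega y(x))$ are the Omega partial derivatives of $L$ with respect to its second and third arguments, evaluated at $(x,y(x),D_\Omega y(x))$. The outer $D_\Omega$ on the left-hand side of the equation is the $\Omega$-derivative of the one-variable function $x\mapsto D_\Omega^3L(x,\tilde y(x),D_\Omega\tilde y(x))$; satisfying the equation includes the existence of this $\Omega$-derivative. Joint convexity (Omega sense): a $C^1$ function $f(x,y,z)$ is jointly convex in $S\subseteq\mathbb{R}^3$ for the variables $y$ and $z$ if $$f(x,y+y_1,z+z_1)-f(x,y,z)\ \ge\ \big(D_\Omega^2f(x,y,z)\big)\,y_1+\big(D_\Omega^3f(x,y,z)\big)\,z_1$$ for all $(x,y,z),(x,y+y_1,z+z_1)\in S$. In the claim this is applied to $f=L$ with $S=I_1\times I_2\times I_3$, the domain of $L$. *)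

(* Defs.v *)
From Stdlib Require Import Reals.
From Coquelicot Require Import Coquelicot.
Open Scope R_scope.

(** Open intervals, bounded or not. *)
Definition is_open_interval (I : R -> Prop) : Prop :=
  exists l u : Rbar, forall x, I x <-> (Rbar_lt l x /\ Rbar_lt x u).

Definition segment (a b : R) (x : R) : Prop := a <= x <= b.

(** The increment [x] is restricted to [[a,b]], so the limit is one-sided at
    [a] and at [b], and values of [f] outside [[a,b]] are irrelevant. *)
Definition is_D_Omega (Omega : R -> R) (a b : R) (f : R -> R) (x0 l : R) : Prop :=
  filterlim (fun x => (f x - f x0) / (Omega x - Omega x0))
            (within (segment a b) (locally' x0)) (locally l).

(** Equal to the limit whenever it exists (for [a < b] and [x0] in [[a,b]]);
    unspecified otherwise. *)
Definition D_Omega (Omega : R -> R) (a b : R) (f : R -> R) (x0 : R) : R :=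
  iota (is_D_Omega Omega a b f x0).

(** Ordinary derivative relative to [[a,b]]. *)
Definition is_derive_segment (a b : R) (f : R -> R) (x0 l : R) : Prop :=
  is_D_Omega (fun x => x) a b f x0 l.

(** [C^2[a,b]], with one-sided derivatives at the endpoints. *)
Definition C2_segment (a b : R) (y : R -> R) : Prop :=
  exists y1 y2 : R -> R,
    (forall x, segment a b x -> is_derive_segment a b y x (y1 x)) /\
    (forall x, segment a b x -> is_derive_segment a b y1 x (y2 x)) /\
    continuous_on (segment a b) y2.

Definition C1_open (J : R -> Prop) (f : R -> R) : Prop :=
  forall x, J x -> ex_derive f x /\ continuous (Derive f) x.

Definition box (I1 I2 I3 : R -> Prop) (x y z : R) : Prop :=
  I1 x /\ I2 y /\ I3 z.

Definition partial1 (f : R -> R -> R -> R) (x y z : R) : R :=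
  Derive (fun t => f t y z) x.
Definition partial2 (f : R -> R -> R -> R) (x y z : R) : R :=
  Derive (fun t => f x t z) y.
Definition partial3 (f : R -> R -> R -> R) (x y z : R) : R :=
  Derive (fun t => f x y t) z.

Definition continuous3 (f : R -> R -> R -> R) (x y z : R) : Prop :=
  continuous (fun p : R * R * R => f (fst (fst p)) (snd (fst p)) (snd p))
             (x, y, z).

(** Existence and joint continuity of the first partial derivatives on [S],
    meant for open [S]; continuity of [f] itself is then automatic. *)
Definition C1_open3 (S : R -> R -> R -> Prop) (f : R -> R -> R -> R) : Prop :=
  forall x y z, S x y z ->
    (ex_derive (fun t => f t y z) x /\
     ex_derive (fun t => f x t z) y /\
     ex_derive (fun t => f x y t) z) /\
    (continuous3 (partial1 f) x y z /\
     continuous3 (partial2 f) x y z /\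
     continuous3 (partial3 f) x y z).

Definition C2_open3 (S : R -> R -> R -> Prop) (f : R -> R -> R -> R) : Prop :=
  C1_open3 S f /\
  C1_open3 S (partial1 f) /\ C1_open3 S (partial2 f) /\ C1_open3 S (partial3 f).

(** Omega partial derivatives: the factor is [Omega'] at the variable with
    respect to which one differentiates. *)
Definition D_Omega2 (Omega : R -> R) (f : R -> R -> R -> R) (x y z : R) : R :=
  / Derive Omega y * partial2 f x y z.
Definition D_Omega3 (Omega : R -> R) (f : R -> R -> R -> R) (x y z : R) : R :=
  / Derive Omega z * partial3 f x y z.

Definition jointly_convex23 (Omega : R -> R) (S : R -> R -> R -> Prop)
    (f : R -> R -> R -> R) : Prop :=
  forall x y z y1 z1, S x y z -> S x (y + y1) (z + z1) ->
    f x (y + y1) (z + z1) - f x y z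
      >= D_Omega2 Omega f x y z * y1 + D_Omega3 Omega f x y z * z1.

Definition functional (Omega : R -> R) (L : R -> R -> R -> R) (a b : R)
    (y : R -> R) : R :=
  RInt (fun x => L x (y x) (D_Omega Omega a b y x) * Derive Omega x) a b.

Definition admissible (Omega : R -> R) (I2 I3 : R -> Prop) (a b ya yb : R)
    (y : R -> R) : Prop :=
  C2_segment a b y /\
  (forall x, segment a b x -> I2 (y x) /\ I3 (D_Omega Omega a b y x)) /\
  y a = ya /\ y b = yb.

Definition Euler_Lagrange (Omega : R -> R) (L : R -> R -> R -> R) (a b : R)
    (y : R -> R) : Prop :=
  forall x, segment a b x ->
    is_D_Omega Omega a b
      (fun t => D_Omega3 Omega L t (y t) (D_Omega Omega a b y t)) x
      (D_Omega2 Omega L x (y x) (D_Omega Omega a b y x)).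

Definition global_minimizer (P : (R -> R) -> Prop) (F : (R -> R) -> R)
    (y0 : R -> R) : Prop :=
  P y0 /\ forall y, P y -> F y0 <= F y.

(* Main.v *)
Require Import Defs.
From Stdlib Require Import Reals Lra.
From Coquelicot Require Import Coquelicot.
Open Scope R_scope.

(** Along [ytilde], write [p] and [q] for the Omega partial derivatives of [L] in
    its third and second variables, and let [h = y - ytilde]. On [[a,b]],
    [D_Omega] is the ordinary derivative divided by [Omega'], so the
    Euler-Lagrange equation reads [p' = q Omega'], and joint convexity bounds the
    difference of the two integrands below by
    [(q h + p D_Omega h) Omega' = p' h + p h' = (p h)']. Hence the difference of
    the two integrals is at least [(p h)(b) - (p h)(a) = 0]. To avoid integrating
    [(p h)'], this last step compares [p h] with the primitive of the difference
    of the integrands through the mean value theorem. *)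

(** * Clamping to the segment, and continuity on it *)

(** The nearest-point retraction of the line onto [[a,b]]. Composing with it turns continuity
    relative to the segment into continuity on the whole line, which the calculus of [RInt] works
    with. *)
Definition clamp (a b x : R) : R := Rmax a (Rmin b x).

Lemma clamp_in_segment (a b x : R) : a <= b -> segment a b (clamp a b x).
Proof.
  intros hab; unfold segment, clamp, Rmax, Rmin.
  destruct (Rle_dec b x); destruct Rle_dec; lra.
Qed.

Lemma clamp_id (a b x : R) : segment a b x -> clamp a b x = x.
Proof.
  unfold segment, clamp, Rmax, Rmin; intros hx.
  destruct (Rle_dec b x); destruct Rle_dec; lra.
Qed.

Lemma clamp_lipschitz (a b x t : R) :
  Rabs (clamp a b t - clamp a b x) <= Rabs (t - x).
Proof.
  unfold clamp, Rmax, Rmin.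
  destruct (Rle_dec b x); destruct (Rle_dec b t);
    repeat destruct Rle_dec; unfold Rabs; repeat destruct Rcase_abs; lra.
Qed.

Lemma continuous_clamp (a b x : R) : continuous (clamp a b) x.
Proof.
  apply filterlim_locally; intros eps.
  exists eps; intros t ht.
  exact (Rle_lt_trans _ _ _ (clamp_lipschitz a b x t) ht).
Qed.

Lemma continuous_comp_clamp (a b : R) (f : R -> R) (x : R) :
  a <= b -> continuous_on (segment a b) f ->
  continuous (fun t => f (clamp a b t)) x.
Proof.
  intros hab hf P hP; unfold continuous_on, filterlim, filter_le, filtermap in *.
  specialize (hf _ (clamp_in_segment a b x hab) P hP).
  apply (filter_imp (fun t => segment a b (clamp a b t) -> P (f (clamp a b t)))).
  - intros t h; exact (h (clamp_in_segment a b t hab)).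
  - exact (continuous_clamp a b x _ hf).
Qed.

Lemma continuous_on_of_continuous (D : R -> Prop) (f : R -> R) :
  (forall x, D x -> continuous f x) -> continuous_on D f.
Proof.
  intros hf x hx P hP; exact (filter_le_within D (fun t => P (f t)) (hf x hx P hP)).
Qed.

Lemma open_interval_open (I : R -> Prop) : is_open_interval I -> open I.
Proof.
  intros [l [u hI]].
  apply (open_ext (fun x : R => Rbar_lt l x /\ Rbar_lt x u)).
  - intros x; split; intros h; now apply hI.
  - apply open_and; [apply open_Rbar_gt | apply open_Rbar_lt].
Qed.

(** * Limits of difference quotients along the segment *)

(** As [a < b], every point of the segment, endpoints included, is an accumulation point of it. This
    makes limits along the filter unique, so that [iota] in [D_Omega] returns the limit. *)
Lemma punctured_segment_proper (a b x : R) :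
  a < b -> segment a b x -> ProperFilter (within (segment a b) (locally' x)).
Proof.
  intros hab [hax hxb]; constructor.
  - intros P [d hd].
    (* Since [e] is at most half the length of the segment, [x + e] or [x - e] lies in it. *)
    set (e := Rmin (d / 2) (b - a) / 2).
    assert (he : 0 < e /\ e < d /\ e <= (b - a) / 2).
    { assert (hd0 := cond_pos d). unfold e, Rmin; destruct Rle_dec; lra. }
    destruct (Rle_dec (x + e) b) as [h | h].
    + exists (x + e); apply hd.
      * change (Rabs (x + e - x) < d). rewrite Rabs_pos_eq; lra.
      * lra.
      * unfold segment; lra.
    + exists (x - e); apply hd.
      * change (Rabs (x - e - x) < d). rewrite Rabs_left; lra.
      * lra.
      * unfold segment; lra.
  - apply within_filter, within_filter, locally_filter.
Qed.

Lemma within_punctured (a b x : R) :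
  within (segment a b) (locally' x) (fun t => segment a b t /\ t <> x).
Proof. exists (mkposreal 1 Rlt_0_1); intros t _ h1 h2; split; assumption. Qed.

(** Chain rule: the quotient against [W2] is the quotient against [W1] times that of [W1] against
    [W2]. Injectivity at [x] lets the increment of [W1] cancel. *)
Lemma is_D_Omega_change_clock (W1 W2 : R -> R) (a b : R) (f : R -> R) (x l m : R) :
  (forall t, segment a b t -> t <> x -> W1 t <> W1 x) ->
  is_D_Omega W1 a b f x l -> is_D_Omega W2 a b W1 x m ->
  is_D_Omega W2 a b f x (l * m).
Proof.
  intros hinj h1 h2.
  assert (FF : Filter (within (segment a b) (locally' x)))
    by apply within_filter, within_filter, locally_filter.
  apply (filterlim_ext_loc
    (fun t => (f t - f x) / (W1 t - W1 x) * ((W1 t - W1 x) / (W2 t - W2 x)))).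
  - apply (filter_imp (fun t => segment a b t /\ t <> x)); [| apply within_punctured].
    intros t [ht1 ht2]; specialize (hinj t ht1 ht2).
    unfold Rdiv; rewrite (Rmult_comm (f t - f x)), (Rmult_comm (W1 t - W1 x) (/ (W2 t - W2 x))).
    rewrite Rmult_comm, Rmult_assoc, <- (Rmult_assoc _ (/ (W1 t - W1 x))).
    rewrite Rinv_r by lra; ring.
  - exact (filterlim_comp_2 _ _ Rmult h1 h2 (filterlim_mult (K := R_AbsRing) l m)).
Qed.

Lemma is_D_Omega_swap (W1 W2 : R -> R) (a b x m : R) :
  m <> 0 -> is_D_Omega W1 a b W2 x m -> is_D_Omega W2 a b W1 x (/ m).
Proof.
  intros hm h.
  apply (filterlim_ext (fun t => / ((W2 t - W2 x) / (W1 t - W1 x)))).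
  (* With [/ 0 = 0], inverting a quotient swaps its terms even where an increment vanishes. *)
  - intros t; unfold Rdiv; rewrite Rinv_mult, Rinv_inv; ring.
  - apply (filterlim_comp _ _ _ _ Rinv _ _ _ h).
    apply (filterlim_Rbar_inv m); congruence.
Qed.

Lemma is_D_Omega_unique (W : R -> R) (a b : R) (f : R -> R) (x l : R) :
  a < b -> segment a b x -> is_D_Omega W a b f x l -> D_Omega W a b f x = l.
Proof.
  intros hab hx h.
  assert (FF := punctured_segment_proper a b x hab hx).
  apply (iota_unique (V := R_CompleteNormedModule)); [| exact h].
  intros l' h'.
  exact (filterlim_locally_unique (V := R_NormedModule) _ _ _ h' h).
Qed.

(** * Ordinary derivatives and derivatives relative to the segment *)

Lemma is_derive_is_derive_segment (a b : R) (f : R -> R) (x l : R) :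
  is_derive f x l -> is_derive_segment a b f x l.
Proof.
  intros h; apply is_derive_Reals in h.
  apply filterlim_locally; intros eps.
  destruct (h eps (cond_pos eps)) as [d hd].
  exists d; intros t ht htx _.
  assert (hd' := hd (t - x)). rewrite Rplus_minus in hd'.
  apply hd'; [lra | exact ht].
Qed.

Lemma is_derive_segment_interior (a b : R) (f : R -> R) (x l : R) :
  a < x < b -> is_derive_segment a b f x l -> is_derive f x l.
Proof.
  intros hx h; apply is_derive_Reals; intros eps heps.
  destruct (proj1 (filterlim_locally _ _) h (mkposreal eps heps)) as [d hd].
  (* This radius also keeps [x + k] inside the segment, where the relative limit gives
     information. *)
  assert (hr : 0 < Rmin d (Rmin (x - a) (b - x))).
  { apply Rmin_case; [apply cond_pos | apply Rmin_case; lra]. }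
  exists (mkposreal _ hr); intros k hk0 hk; simpl in hk.
  assert (hkd := Rlt_le_trans _ _ _ hk (Rmin_l _ _)).
  assert (hk' := Rlt_le_trans _ _ _ hk (Rmin_r _ _)).
  assert (hka := Rlt_le_trans _ _ _ hk' (Rmin_l _ _)).
  assert (hkb := Rlt_le_trans _ _ _ hk' (Rmin_r _ _)).
  apply Rabs_def2 in hka, hkb.
  assert (hd' := hd (x + k)). simpl in hd'.
  replace k with (x + k - x) at 2 by ring.
  apply hd'.
  - change (Rabs (x + k - x) < d). now replace (x + k - x) with k by ring.
  - lra.
  - unfold segment; lra.
Qed.

(** Near [x] the difference quotient is bounded by [Rabs (df x) + 1], so the increment of [f] is at
    most this constant times that of the variable. *)
Lemma is_derive_segment_continuous_on (a b : R) (f df : R -> R) :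
  (forall x, segment a b x -> is_derive_segment a b f x (df x)) ->
  continuous_on (segment a b) f.
Proof.
  intros h x hx.
  apply filterlim_locally; intros eps.
  destruct (proj1 (filterlim_locally _ _) (h x hx) (mkposreal 1 Rlt_0_1)) as [d hd].
  assert (hC : 0 < Rabs (df x) + 1) by (assert (h0 := Rabs_pos (df x)); lra).
  assert (hr : 0 < Rmin d (eps / (Rabs (df x) + 1))).
  { apply Rmin_case; [apply cond_pos |].
    apply Rdiv_lt_0_compat; [apply cond_pos | exact hC]. }
  exists (mkposreal _ hr); intros t ht hts.
  destruct (Req_dec t x) as [-> | htx]; [apply ball_center |].
  change (Rabs (t - x) < Rmin d (eps / (Rabs (df x) + 1))) in ht.
  change (Rabs (f t - f x) < eps).
  assert (hq := hd t (Rlt_le_trans _ _ _ ht (Rmin_l _ _)) htx hts).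
  change (Rabs ((f t - f x) / (t - x) - df x) < 1) in hq.
  assert (hq' : Rabs ((f t - f x) / (t - x)) < Rabs (df x) + 1).
  { replace ((f t - f x) / (t - x)) with ((f t - f x) / (t - x) - df x + df x) by ring.
    assert (ht' := Rabs_triang ((f t - f x) / (t - x) - df x) (df x)); lra. }
  replace (f t - f x) with ((f t - f x) / (t - x) * (t - x)) by (field; lra).
  rewrite Rabs_mult.
  replace (pos eps) with ((Rabs (df x) + 1) * (eps / (Rabs (df x) + 1))) by (field; lra).
  apply Rmult_le_0_lt_compat; try apply Rabs_pos; trivial.
  exact (Rlt_le_trans _ _ _ ht (Rmin_r _ _)).
Qed.

(** * Continuity for functions of three variables *)

(** Continuous partial derivatives are locally bounded; changing one coordinate at a time, the mean
    value inequality bounds the increment of [f]. *)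
Lemma C1_open3_continuous3 (S : R -> R -> R -> Prop) (f : R -> R -> R -> R) (x y z : R) :
  locally (x, y, z) (fun p : R * R * R => S (fst (fst p)) (snd (fst p)) (snd p)) ->
  C1_open3 S f -> continuous3 f x y z.
Proof.
  intros hS hf.
  assert (hbnd : forall g, continuous3 g x y z ->
    locally (x, y, z) (fun p : R * R * R =>
      Rabs (g (fst (fst p)) (snd (fst p)) (snd p)) <= Rabs (g x y z) + 1)).
  { intros g hg.
    apply (filter_imp _ _) with (2 := proj1 (filterlim_locally _ _) hg (mkposreal 1 Rlt_0_1)).
    intros [[u v] w] hp; simpl in hp |- *.
    change (Rabs (g u v w - g x y z) < 1) in hp.
    replace (g u v w) with (g u v w - g x y z + g x y z) by ring.
    assert (ht := Rabs_triang (g u v w - g x y z) (g x y z)); lra. }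
  destruct (hf x y z (locally_singleton _ _ hS)) as [_ [c1 [c2 c3]]].
  (* A common bound for the three partial derivatives near [(x, y, z)]. *)
  set (M := Rabs (partial1 f x y z) + Rabs (partial2 f x y z) + Rabs (partial3 f x y z) + 1).
  assert (p1 := Rabs_pos (partial1 f x y z)).
  assert (p2 := Rabs_pos (partial2 f x y z)).
  assert (p3 := Rabs_pos (partial3 f x y z)).
  assert (hM : 0 < M) by (unfold M; lra).
  destruct (filter_and _ _ hS (filter_and _ _ (hbnd _ c1)
    (filter_and _ _ (hbnd _ c2) (hbnd _ c3)))) as [d hd].
  assert (hd' : forall u v w, Rabs (u - x) < d -> Rabs (v - y) < d -> Rabs (w - z) < d ->
    S u v w /\ Rabs (partial1 f u v w) <= M /\ Rabs (partial2 f u v w) <= M /\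
    Rabs (partial3 f u v w) <= M).
  { intros u v w hu hv hw.
    destruct (hd (u, v, w)) as [q0 [q1 [q2 q3]]]; [repeat split; assumption |].
    simpl in q0, q1, q2, q3; unfold M; repeat split; trivial; lra. }
  clear hd.
  apply filterlim_locally; intros eps.
  (* Each of the three coordinate moves then costs less than [eps / 3]. *)
  assert (hr : 0 < Rmin d (eps / (3 * M))).
  { apply Rmin_case; [apply cond_pos |].
    apply Rdiv_lt_0_compat; [apply cond_pos | lra]. }
  exists (mkposreal _ hr); intros [[u v] w] [[hu hv] hw]; simpl in hu, hv, hw |- *.
  change (Rabs (u - x) < Rmin d (eps / (3 * M))) in hu.
  change (Rabs (v - y) < Rmin d (eps / (3 * M))) in hv.
  change (Rabs (w - z) < Rmin d (eps / (3 * M))) in hw.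
  change (Rabs (f u v w - f x y z) < eps).
  assert (hu1 := Rlt_le_trans _ _ _ hu (Rmin_l _ _)).
  assert (hu2 := Rlt_le_trans _ _ _ hu (Rmin_r _ _)).
  assert (hv1 := Rlt_le_trans _ _ _ hv (Rmin_l _ _)).
  assert (hv2 := Rlt_le_trans _ _ _ hv (Rmin_r _ _)).
  assert (hw1 := Rlt_le_trans _ _ _ hw (Rmin_l _ _)).
  assert (hw2 := Rlt_le_trans _ _ _ hw (Rmin_r _ _)).
  assert (hd0 : forall s, Rabs (s - s) < d)
    by (intros s; rewrite Rminus_diag, Rabs_R0; apply cond_pos).
  assert (e1 : Rabs (f u v w - f x v w) <= M * Rabs (u - x)).
  { apply (bounded_variation (fun t => f t v w) (fun t => partial1 f t v w)).
    intros t ht; destruct (hd' t v w) as [q0 [q1 _]]; trivial; try lra.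
    split; [apply Derive_correct, (hf _ _ _ q0) | exact q1]. }
  assert (e2 : Rabs (f x v w - f x y w) <= M * Rabs (v - y)).
  { apply (bounded_variation (fun t => f x t w) (fun t => partial2 f x t w)).
    intros t ht; destruct (hd' x t w) as [q0 [_ [q2 _]]]; trivial; try lra.
    split; [apply Derive_correct, (hf _ _ _ q0) | exact q2]. }
  assert (e3 : Rabs (f x y w - f x y z) <= M * Rabs (w - z)).
  { apply (bounded_variation (fun t => f x y t) (fun t => partial3 f x y t)).
    intros t ht; destruct (hd' x y t) as [q0 [_ [_ q3]]]; trivial; try lra.
    split; [apply Derive_correct, (hf _ _ _ q0) | exact q3]. }
  apply (Rmult_lt_compat_l M) in hu2, hv2, hw2; trivial.
  replace (M * (eps / (3 * M))) with (eps / 3) in hu2, hv2, hw2 by (field; lra).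
  apply Rabs_le_between in e1, e2, e3; apply Rabs_def1; lra.
Qed.

Lemma continuous_comp3 (f : R -> R -> R -> R) (u v w : R -> R) (x : R) :
  continuous u x -> continuous v x -> continuous w x ->
  continuous3 f (u x) (v x) (w x) -> continuous (fun t => f (u t) (v t) (w t)) x.
Proof.
  intros hu hv hw hf.
  apply (continuous_comp_2 (fun t => (u t, v t)) w (fun p r => f (fst p) (snd p) r)); trivial.
  apply (continuous_comp_2 u v (fun p r => (p, r))); trivial.
  apply (continuous_ext (fun p : R * R => p)); [now intros [p r] | apply continuous_id].
Qed.

(** * Comparing an increment with an integral *)

(** On []a,b[] the function [RInt f a t - G t] of [t] has derivative [f - dG >= 0], so its value at
    [b] is at least its value [- G a] at [a]. *)
Lemma increment_le_RInt (f G dG : R -> R) (a b : R) :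
  a < b -> (forall x, continuous f x) -> (forall x, continuous G x) ->
  (forall x, a < x < b -> is_derive G x (dG x) /\ dG x <= f x) ->
  G b - G a <= RInt f a b.
Proof.
  intros hab hf hG hdG.
  assert (hI : forall x, is_derive (fun t => RInt f a t) x (f x)).
  { intros x; apply (is_derive_RInt f _ a); [| apply hf].
    apply filter_forall; intros t; apply (RInt_correct f).
    apply (ex_RInt_continuous f); intros; apply hf. }
  (* The mean value theorem may return an endpoint, where nothing is known
     about [dG]; hence the truncation by [Rmax 0]. *)
  destruct (MVT_gen (fun t => RInt f a t - G t) a b (fun t => Rmax 0 (f t - dG t)))
    as [c [_ heq]].
  - rewrite Rmin_left, Rmax_right by lra; intros x hx.
    destruct (hdG x hx) as [h1 h2]; rewrite Rmax_right by lra.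
    exact (is_derive_minus (fun t => RInt f a t) G x _ _ (hI x) h1).
  - intros x _; apply continuity_pt_filterlim.
    apply (continuous_minus (fun t => RInt f a t) G); [| apply hG].
    apply (ex_derive_continuous (fun t => RInt f a t)); eexists; apply hI.
  - assert (h0 : 0 <= Rmax 0 (f c - dG c) * (b - a))
      by (apply Rmult_le_pos; [apply Rmax_l | lra]).
    rewrite <- heq, (RInt_point a f : RInt f a a = 0) in h0; lra.
Qed.

(** * The Omega-derivative for a [C^1] function with positive derivative *)

Section OmegaClock.

Variables (J : R -> Prop) (Omega : R -> R) (a b : R).
Hypothesis hab : a < b.
Hypothesis hJ : forall x, segment a b x -> J x.
Hypothesis hOmega : C1_open J Omega.
Hypothesis hOmega' : forall x, J x -> 0 < Derive Omega x.

(** By the mean value theorem the increment of [Omega] is a positive value of its derivative times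
    [t - x]. *)
Lemma Omega_injective (x t : R) :
  segment a b x -> segment a b t -> t <> x -> Omega t <> Omega x.
Proof.
  intros hx ht htx heq.
  assert (hs : forall s, Rmin x t <= s <= Rmax x t -> J s).
  { intros s hs; apply hJ; unfold segment, Rmin, Rmax in *; destruct Rle_dec; lra. }
  destruct (MVT_gen Omega x t (Derive Omega)) as [c [hc h]].
  - intros s hs'; apply Derive_correct, hOmega, hs; lra.
  - intros s hs'; apply continuity_pt_filterlim.
    apply (ex_derive_continuous Omega), hOmega, hs, hs'.
  - assert (hc0 := hOmega' c (hs c hc)).
    assert (h0 : Derive Omega c * (t - x) = 0) by lra.
    apply Rmult_integral in h0; lra.
Qed.

Lemma is_derive_segment_Omega (x : R) :
  segment a b x -> is_derive_segment a b Omega x (Derive Omega x).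
Proof.
  intros hx; apply is_derive_is_derive_segment, Derive_correct, hOmega, hJ, hx.
Qed.

Lemma is_D_Omega_is_derive_segment (f : R -> R) (x l : R) :
  segment a b x -> is_D_Omega Omega a b f x l ->
  is_derive_segment a b f x (l * Derive Omega x).
Proof.
  intros hx h; apply (is_D_Omega_change_clock Omega); trivial.
  - intros t; now apply Omega_injective.
  - now apply is_derive_segment_Omega.
Qed.

Lemma is_derive_segment_is_D_Omega (f : R -> R) (x l : R) :
  segment a b x -> is_derive_segment a b f x l ->
  is_D_Omega Omega a b f x (l * / Derive Omega x).
Proof.
  intros hx h; apply (is_D_Omega_change_clock (fun t => t)); trivial.
  apply is_D_Omega_swap.
  - assert (h0 := hOmega' x (hJ x hx)); lra.
  - now apply is_derive_segment_Omega.
Qed.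

Lemma continuous_on_Derive_Omega : continuous_on (segment a b) (Derive Omega).
Proof.
  apply continuous_on_of_continuous; intros x hx; apply hOmega, hJ, hx.
Qed.

(** On the segment [D_Omega y] is [y1 / Omega'], where [y1] is continuous because it is
    differentiable there and [Omega'] is continuous and positive. *)
Lemma D_Omega_of_C2 (y : R -> R) :
  C2_segment a b y ->
  continuous_on (segment a b) y /\
  continuous_on (segment a b) (D_Omega Omega a b y) /\
  forall x, segment a b x ->
    is_derive_segment a b y x (D_Omega Omega a b y x * Derive Omega x).
Proof.
  intros [y1 [y2 [h1 [h2 _]]]].
  assert (hD : forall x, segment a b x ->
    D_Omega Omega a b y x = y1 x * / Derive Omega x).
  { intros x hx; apply is_D_Omega_unique; trivial.
    apply is_derive_segment_is_D_Omega; auto. }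
  split; [| split].
  - exact (is_derive_segment_continuous_on a b y y1 h1).
  - intros x hx; rewrite (hD x hx).
    apply (filterlim_within_ext _ (fun t => y1 t * / Derive Omega t));
      [intros t ht; symmetry; now apply hD |].
    assert (FF : Filter (within (segment a b) (locally x)))
      by apply within_filter, locally_filter.
    apply (filterlim_comp_2 _ _ Rmult
      (is_derive_segment_continuous_on a b y1 y2 h2 x hx)) with (2 := filterlim_mult (K := R_AbsRing) _ _).
    apply (filterlim_comp _ _ _ _ Rinv _ _ _ (continuous_on_Derive_Omega x hx)).
    apply (filterlim_Rbar_inv (Derive Omega x)).
    assert (h0 := hOmega' x (hJ x hx)); intros h; injection h; lra.
  - intros x hx; apply is_D_Omega_is_derive_segment; trivial.
    rewrite hD by trivial; apply is_derive_segment_is_D_Omega; auto.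
Qed.

End OmegaClock.

(** * From the Euler-Lagrange equation and convexity to minimality *)

Theorem theorem7 (I1 I2 I3 J : R -> Prop) (a b ya yb : R)
    (Omega : R -> R) (L : R -> R -> R -> R) (ytilde : R -> R)
    (hI1 : is_open_interval I1) (hI2 : is_open_interval I2) (hI3 : is_open_interval I3)
    (hab : a < b) (habI1 : forall x, segment a b x -> I1 x)
    (hJ : is_open_interval J) (hIJ : forall x, I1 x \/ I2 x \/ I3 x -> J x)
    (hOmega : C1_open J Omega) (hOmega' : forall x, J x -> 0 < Derive Omega x)
    (hL : C2_open3 (box I1 I2 I3) L)
    (hconv : jointly_convex23 Omega (box I1 I2 I3) L)
    (hy : admissible Omega I2 I3 a b ya yb ytilde)
    (hEL : Euler_Lagrange Omega L a b ytilde) :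
  global_minimizer (admissible Omega I2 I3 a b ya yb)
    (functional Omega L a b) ytilde.
Proof.
  split; [exact hy | intros y hy'].
  assert (hseg : forall x, segment a b x -> J x) by (intros x hx; apply hIJ; auto).
  assert (hab' : a <= b) by lra.
  set (c := clamp a b).
  assert (hc : forall x, segment a b (c x)) by (intros x; now apply clamp_in_segment).
  assert (hcid : forall x, segment a b x -> c x = x) by (intros x; apply clamp_id).
  set (D := fun u => D_Omega Omega a b u).
  (* The integrand of the functional, extended from the segment to a continuous function on the
     line. *)
  set (K := fun (u : R -> R) t =>
    L (c t) (u (c t)) (D u (c t)) * Derive Omega (c t)).
  assert (hK : forall u, admissible Omega I2 I3 a b ya yb u ->
    (forall x, continuous (K u) x) /\ functional Omega L a b u = RInt (K u) a b).
  { intros u [hu2 [huI _]]; split.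
    - intros x.
      destruct (D_Omega_of_C2 J Omega a b hab hseg hOmega hOmega' u hu2) as [cu [cD _]].
      apply (continuous_mult (fun t => L (c t) (u (c t)) (D u (c t)))
        (fun t => Derive Omega (c t))).
      + apply (continuous_comp3 L c (fun t => u (c t)) (fun t => D u (c t))).
        * apply continuous_clamp.
        * now apply continuous_comp_clamp.
        * now apply continuous_comp_clamp.
        * apply (C1_open3_continuous3 (box I1 I2 I3)); [| apply hL].
          destruct (huI _ (hc x)) as [hx2 hx3].
          destruct (open_interval_open _ hI1 _ (habI1 _ (hc x))) as [d1 hd1].
          destruct (open_interval_open _ hI2 _ hx2) as [d2 hd2].
          destruct (open_interval_open _ hI3 _ hx3) as [d3 hd3].
          (* The box is a neighbourhood of the point: the smallest of the three radii serves. *)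
          assert (hr : 0 < Rmin d1 (Rmin d2 d3))
            by (repeat apply Rmin_case; apply cond_pos).
          exists (mkposreal _ hr); intros [[p q] r] [[hp hq] hr']; simpl in *.
          repeat split; [apply hd1 | apply hd2 | apply hd3];
            eapply ball_le; [| eassumption | | eassumption | | eassumption]; simpl.
          -- apply Rmin_l.
          -- eapply Rle_trans; [apply Rmin_r | apply Rmin_l].
          -- eapply Rle_trans; [apply Rmin_r | apply Rmin_r].
      + apply continuous_comp_clamp; trivial.
        now apply (continuous_on_Derive_Omega J).
    - apply RInt_ext; rewrite Rmin_left, Rmax_right by lra; intros x hx.
      unfold K; rewrite hcid by (unfold segment; lra); reflexivity. }
  destruct (hK ytilde hy) as [c0 F0]; destruct (hK y hy') as [c1 F1].
  rewrite F0, F1.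
  destruct hy as [hy2 [hyI [hya hyb]]]; destruct hy' as [hz2 [hzI [hza hzb]]].
  destruct (D_Omega_of_C2 J Omega a b hab hseg hOmega hOmega' _ hy2) as [ycont [_ yder]].
  destruct (D_Omega_of_C2 J Omega a b hab hseg hOmega hOmega' _ hz2) as [zcont [_ zder]].
  set (p := fun t => D_Omega3 Omega L t (ytilde t) (D ytilde t)).
  set (q := fun t => D_Omega2 Omega L t (ytilde t) (D ytilde t)).
  (* The Euler-Lagrange equation in ordinary derivatives: [p' = q Omega']. *)
  assert (pder : forall x, segment a b x ->
    is_derive_segment a b p x (q x * Derive Omega x)).
  { intros x hx; apply (is_D_Omega_is_derive_segment J); trivial. now apply hEL. }
  assert (pcont := is_derive_segment_continuous_on a b p _ pder).
  set (G := fun t => p (c t) * (y (c t) - ytilde (c t))).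
  assert (hG : G b - G a <= RInt (fun t => K y t - K ytilde t) a b).
  (* [dG] is the product rule for [p (y - ytilde)], with [p'] rewritten by the Euler-Lagrange
     equation. *)
  { apply increment_le_RInt with (dG := fun x =>
      q x * Derive Omega x * (y x - ytilde x) +
      p x * (D y x * Derive Omega x - D ytilde x * Derive Omega x)); trivial.
    - intros x; now apply (continuous_minus (K y) (K ytilde)).
    - intros x.
      apply (continuous_mult (fun t => p (c t)) (fun t => y (c t) - ytilde (c t)));
        [now apply continuous_comp_clamp |].
      apply (continuous_minus (fun t => y (c t)) (fun t => ytilde (c t)));
        now apply continuous_comp_clamp.
    - intros x hx.
      assert (hxs : segment a b x) by (unfold segment; lra).
      split.
      (* Around an interior point the clamp is the identity. *)
      + apply (is_derive_ext_loc (fun t => p t * (y t - ytilde t))).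
        { apply (filter_imp (fun t : R => Rbar_lt a t /\ Rbar_lt t b)).
          - intros t ht; simpl in ht; unfold G; rewrite hcid; trivial; unfold segment; lra.
          - apply (open_and _ _ (open_Rbar_gt a) (open_Rbar_lt b) x hx). }
        apply (is_derive_mult p (fun t => y t - ytilde t));
          [| apply (is_derive_minus y ytilde) | intros; apply Rmult_comm];
          apply (is_derive_segment_interior a b); auto.
      + unfold K; rewrite hcid by trivial.
        destruct (hyI x hxs) as [hy2x hy3x]; destruct (hzI x hxs) as [hz2x hz3x].
        (* Convexity at the point of [ytilde], with increments leading to the point of [y];
           multiplied by [Omega' > 0] it becomes [dG <= K y - K ytilde]. *)
        assert (hcv := hconv x (ytilde x) (D ytilde x) (y x - ytilde x) (D y x - D ytilde x)).
        replace (ytilde x + (y x - ytilde x)) with (y x) in hcv by ring.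
        replace (D ytilde x + (D y x - D ytilde x)) with (D y x) in hcv by ring.
        specialize (hcv (conj (habI1 x hxs) (conj hy2x hy3x))
          (conj (habI1 x hxs) (conj hz2x hz3x))).
        apply Rge_le, (Rmult_le_compat_r (Derive Omega x)) in hcv;
          [| apply Rlt_le, hOmega', hseg, hxs].
        unfold p, q; lra. }
  assert (hIK : forall u, (forall x, continuous (K u) x) -> ex_RInt (K u) a b)
    by (intros; apply (ex_RInt_continuous (K u)); auto).
  assert (hsub := RInt_minus (K y) (K ytilde) a b (hIK _ c1) (hIK _ c0)).
  change (RInt (fun t => K y t - K ytilde t) a b = RInt (K y) a b - RInt (K ytilde) a b) in hsub.
  rewrite hsub in hG; unfold G in hG.
  (* [y] and [ytilde] share their boundary values, so [G] vanishes at [a] and at [b]. *)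
  rewrite !hcid, hya, hyb, hza, hzb in hG by (unfold segment; lra).
  lra.
Qed.
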